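(* The algorithm $A$ described in the context, using the labels described there, is a $k$-gathering algorithm which works in time $O(D\Delta)$ with labels of size $O(\log\Delta)$.
   Context: Radio network: a simple undirected connected graph $G=(V,E)$ with diameter $D$ and maximum degree $\Delta$. Nodes communicate in synchronous rounds. In each round a node either transmits a message to all its neighbors or listens. A node $v$ hears a neighbor $w$ in a round iff $v$ listens and $w$ is the only neighbor of $v$ that transmits in this round; otherwise $v$ receives nothing and cannot tell whether any neighbor transmitted. Message size is unrestricted, so several source messages may be combined in one transmission. Non-spontaneous wake-up: only sources start at round $0$; every other node joins only after receiving a message. The current round number is added to every message, so awakened nodes know the global round number. Each node initially knows only its label (a binary string; labels need not be distinct) and, if it is a source, its message. The size of the labels is the maximum length of a label; time is the number of rounds. $k$-gathering: there are $k$ nodes $s_1,\dots,s_k$ (sources), each holding a message, and a node $r$ (the sink); all $k$ messages have to reach $r$. Objects used for the labels. Let $T$ be a fixed BFS tree of $G$ rooted at the sink $r$, and let $p(v)$ be the parent of $v$ in $T$. Let $T'$ be the smallest (with respect to inclusion) subtree of $T$ containing $r$ and all sources; every leaf of $T'$ is a source. Let $s:V\to\{0,\dots,\Delta-1\}$ be a function such that (a) $s(u)\ne s(w)$ for any two different children $u,w$ of the same node in $T$, and (b) there is no edge of $G$ between $u$ and $p(w)$ for any two nodes $u\ne w$ on the same level of $T$ with $s(u)=s(w)$. Let $c:V\to\{0,\dots,\Delta^2\}$ be a distance-two coloring of $G$ (different nodes at distance at most 2 have different colors). Labels: the label of $v$ consists of $s(v)$, $c(v)$, $c(p(v))$, $\Delta$,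 the number of children of $v$ in $T'$, and $l(v)\in\{0,1,2\}$, the level of $v$ in $T$ (its distance to the root) modulo 3. Algorithm $A$: the execution is split into phases, each consisting of three rounds $0,1,2$. A node $v$ that is supposed to send a message in a phase transmits in round $l(v)$ of that phase. At the beginning only the leaves of $T'$ are active; a leaf $v$ of $T'$ transmits its message in phase $s(v)$. Each non-leaf node $v$ of $T'$ (one whose stored number of children is larger than 0) sends nothing until it has received messages from all its children in $T'$. If it receives the last message from a child in phase $t$, then it transmits all received messages (together with its own source message, if it is a source) in the closest phase $t'>t$ with $t'\bmod\Delta=s(v)$, and it is inactive in all other phases. Each transmitting node $v$ appends $c(v)$ and $c(p(v))$ to its message. A node recognizes a received message as coming from a child by the appended parent color being equal to its own color, distinguishes different children by their appended colors, and knows that it has heard from all of its children by comparing with the number of children stored in its label. *)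

(* Defs.v *)
From mathcomp Require Import all_boot.

Set Implicit Arguments.
Unset Strict Implicit.
Unset Printing Implicit Defensive.

(* Graphs are irreflexive symmetric relations on a finite type. *)

Section Graphs.

Variables (V : finType) (E : rel V).

Definition connected_graph : Prop :=
  [/\ symmetric E, irreflexive E & forall u v, connect E u v].

(* Length of a shortest walk from u to v; #|V| if there is none. *)
Definition dist (u v : V) : nat :=
  find (fun n => [exists q : n.-tuple V, path E u q && (last u q == v)])
       (iota 0 #|V|).

Definition diameter : nat := \max_(u : V) \max_(v : V) dist u v.

Definition max_degree : nat := \max_(v : V) #|[set w | E v w]|.

Definition distance2_coloring (C : eqType) (c : V -> C) : Prop :=
  forall u v : V, u != v -> dist u v <= 2 -> c u != c v.

(* A tree rooted at r is given by its parent function p, with p r = r. *)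

Definition spanning_tree (r : V) (p : V -> V) : Prop :=
  [/\ p r = r,
      forall v, v != r -> E v (p v)
    & forall v, fconnect p v r].

(* [findex p v r] is the number of parent steps from v to r. *)
Definition level (r : V) (p : V -> V) (v : V) : nat := findex p v r.

Definition bfs_tree (r : V) (p : V -> V) : Prop :=
  spanning_tree r p /\ forall v, level r p v = dist r v.

Definition child_of (r : V) (p : V -> V) (u v : V) : bool :=
  (u != r) && (p u == v).

Definition tree_edge (r : V) (p : V -> V) : rel V :=
  [rel u v | child_of r p u v || child_of r p v u].

(* W is the vertex set of a subtree, i.e. of a nonempty connected subgraph. *)
Definition subtree (r : V) (p : V -> V) (W : {set V}) : Prop :=
  W != set0 /\
  forall u v, u \in W -> v \in W ->
    connect [rel x y | [&& x \in W, y \in W & tree_edge r p x y]] u v.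

Definition smallest_subtree (r : V) (p : V -> V) (src W : {set V}) : Prop :=
  [/\ subtree r p W, r \in W, src \subset W
    & forall W' : {set V},
        subtree r p W' -> r \in W' -> src \subset W' -> W \subset W'].

Definition num_children (r : V) (p : V -> V) (W : {set V}) (v : V) : nat :=
  #|[set u in W | child_of r p u v]|.

Definition slot_function (r : V) (p : V -> V) (C : eqType) (s : V -> C) : Prop :=
  (forall u w : V, u != w -> u != r -> w != r -> p u = p w -> s u != s w) /\
  (forall u w : V, u != w -> level r p u = level r p w -> s u = s w ->
     ~~ E u (p w)).

End Graphs.

(* Deterministic protocols for radio networks, uniform over all networks. What
   a node v knows in round t is its binary label, its source message (None if v
   is not a source), the global round number t, and the packets heard so far in
   chronological order, each with the round number added to it by the sender. *)

Record protocol (M : eqType) := Protocol {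
  packet : Type;
  (* Some m: transmit m; None: listen *)
  decide : bitseq -> option M -> nat -> seq (nat * packet) -> option packet;
  (* the source messages known to the node *)
  output : bitseq -> option M -> seq (nat * packet) -> seq M
}.

Arguments decide {M} _ _ _ _ _.
Arguments output {M} _ _ _ _.

Section Execution.

Variables (M : eqType) (P : protocol M) (V : finType) (E : rel V).
Variables (lab : V -> bitseq) (inp : V -> option M).

Definition state := V -> seq (nat * packet P).

(* A non-source that has not heard anything is asleep, hence does not transmit. *)
Definition act (H : state) (t : nat) (v : V) : option (packet P) :=
  if isSome (inp v) || ~~ nilp (H v)
  then decide P (lab v) (inp v) t (H v) else None.

Definition heard (a : V -> option (packet P)) (v : V) : option (packet P) :=
  if isSome (a v) then None
  else if [seq w <- enum V | E v w && isSome (a w)] is [:: w] then a w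
  else None.

(* [history t v]: the packets heard by v in rounds 0, ..., t - 1. *)
Fixpoint history (t : nat) : state :=
  if t is t'.+1 then
    fun v => if heard (act (history t') t') v is Some m
             then rcons (history t' v) (t', m) else history t' v
  else fun _ => [::].

Definition action (t : nat) (v : V) : option (packet P) := act (history t) t v.

End Execution.

Definition source_input (V : finType) (M : eqType) (src : {set V}) (msg : V -> M)
  (v : V) : option M := if v \in src then Some (msg v) else None.

(* After T rounds the sink r knows all source messages, and the execution is
   over: nobody transmits any more. *)
Definition gathers_in_time (M : eqType) (P : protocol M) (V : finType)
    (E : rel V) (lab : V -> bitseq) (r : V) (src : {set V}) (msg : V -> M)
    (T : nat) : Prop :=
  let inp := source_input src msg in
  (forall u, u \in src ->
     msg u \in output P (lab r) (inp r) (history P E lab inp T r)) /\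
  (forall t v, T <= t -> action P E lab inp t v = None).

(* Self-delimiting code of a natural number: every binary digit, least
   significant first, is preceded by true, and false ends the code. *)

Fixpoint encode_nat_rec (fuel n : nat) : bitseq :=
  if fuel is fuel'.+1 then
    if n == 0 then [:: false]
    else [:: true, odd n & encode_nat_rec fuel' n./2]
  else [:: false].

Definition encode_nat (n : nat) : bitseq := encode_nat_rec n n.

(* The decoder also returns the rest of the string. *)
Fixpoint decode_nat (b : bitseq) : nat * bitseq :=
  match b with
  | true :: d :: b' => let: (n, rest) := decode_nat b' in (d + n.*2, rest)
  | _ :: b' => (0, b')
  | [::] => (0, [::])
  end.

Record label := Label {
  slot : nat;          (* s(v) *)
  color : nat;         (* c(v) *)
  parent_color : nat;  (* c(p(v)) *)
  max_deg : nat;       (* Delta *)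
  nchildren : nat;     (* number of children of v in T' *)
  level_mod3 : nat     (* l(v) *)
}.

Definition encode_label (L : label) : bitseq :=
  encode_nat (slot L) ++ encode_nat (color L) ++ encode_nat (parent_color L) ++
  encode_nat (max_deg L) ++ encode_nat (nchildren L) ++
  encode_nat (level_mod3 L).

Definition decode_label (b : bitseq) : label :=
  let: (x1, b1) := decode_nat b in
  let: (x2, b2) := decode_nat b1 in
  let: (x3, b3) := decode_nat b2 in
  let: (x4, b4) := decode_nat b3 in
  let: (x5, b5) := decode_nat b4 in
  let: (x6, _) := decode_nat b5 in
  Label x1 x2 x3 x4 x5 x6.

(* For the root, p r = r, so that c(r) is stored as its parent color. *)
Definition labeling (V : finType) (E : rel V) (r : V) (p : V -> V)
    (s : V -> 'I_(max_degree E)) (c : V -> 'I_(max_degree E ^ 2).+1)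
    (T' : {set V}) (v : V) : bitseq :=
  encode_label (Label (s v) (c v) (c (p v)) (max_degree E)
                      (num_children r p T' v) (level r p v %% 3)).

(* The gathering algorithm: phase q consists of the rounds 3q, 3q+1, 3q+2. *)

Section Algorithm.

Variable M : eqType.

Record gpacket := GPacket {
  pk_msgs : seq M;
  pk_color : nat;
  pk_parent_color : nat
}.

Definition from_child (L : label) (x : nat * gpacket) : bool :=
  pk_parent_color x.2 == color L.

Definition heard_children (L : label) (h : seq (nat * gpacket)) : nat :=
  size (undup [seq pk_color x.2 | x <- h & from_child L x]).

Definition last_child_phase (L : label) (h : seq (nat * gpacket)) : nat :=
  last 0 [seq x.1 | x <- h & from_child L x] %/ 3.

(* q' is the least number larger than q that is congruent to s modulo delta. *)
Definition closest_phase (delta s q q' : nat) : bool :=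
  [&& q < q', q' %% delta == s
    & all (fun i => i %% delta != s) (index_iota q.+1 q')].

(* A non-source with nchildren = 0 is outside T' and never sends. *)
Definition sends_in_phase (L : label) (own : option M)
    (h : seq (nat * gpacket)) (q : nat) : bool :=
  if nchildren L == 0 then isSome own && (q == slot L)
  else (heard_children L h == nchildren L) &&
       closest_phase (max_deg L) (slot L) (last_child_phase L h) q.

Definition known_messages (own : option M) (h : seq (nat * gpacket)) : seq M :=
  seq_of_opt own ++ flatten [seq pk_msgs x.2 | x <- h].

Definition messages_to_send (L : label) (own : option M)
    (h : seq (nat * gpacket)) : seq M :=
  if nchildren L == 0 then seq_of_opt own else known_messages own h.

Definition gather_decide (b : bitseq) (own : option M) (t : nat)
    (h : seq (nat * gpacket)) : option gpacket :=
  let L := decode_label b in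
  if (t %% 3 == level_mod3 L) && sends_in_phase L own h (t %/ 3)
  then Some (GPacket (messages_to_send L own h) (color L) (parent_color L))
  else None.

Definition gathering_algorithm : protocol M :=
  Protocol gather_decide (fun _ own h => known_messages own h).

End Algorithm.

(* Main.v *)
(* A transmission of a node v <> r is always heard by its parent: rounds separate
   the levels modulo 3, neighbours of p v lie within one level of p v, and slots
   separate the nodes on the level of v. By the coloring, a packet that v takes
   for one of its children's really comes from a child in T', and different
   children have different colors; so v sends only once every child in T' has been
   heard. Hence, by induction on time, a packet of v contains all source messages
   below v, and, since each level adds at most Delta phases, a node on level i
   sends only in phases smaller than (D - i + 1) Delta. By induction from the
   deepest level upwards, every node of T' other than r does send. *)

From HB Require Import structures.
Require Import Defs.
From mathcomp Require Import all_boot.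
From mathcomp Require Import zify.

Set Implicit Arguments.
Unset Strict Implicit.
Unset Printing Implicit Defensive.

(** * Decoding and length of labels *)

Lemma encode_nat_recK fuel n rest :
  n <= fuel -> decode_nat (encode_nat_rec fuel n ++ rest) = (n, rest).
Proof.
elim: fuel n => [|fuel IH] n /=; first by rewrite leqn0 => /eqP->.
case: eqP => [-> //|n0] le_n /=.
rewrite IH; first by rewrite odd_double_half.
lia.
Qed.

Lemma encode_natK n rest : decode_nat (encode_nat n ++ rest) = (n, rest).
Proof. exact: encode_nat_recK. Qed.

Lemma encode_labelK L : decode_label (encode_label L) = L.
Proof.
case: L => a b d e f g; rewrite /decode_label /encode_label /=.
by rewrite !encode_natK -[encode_nat g]cats0 encode_natK.
Qed.

(** Each binary digit costs two bits and the end mark one; running out of fuel only shortens the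
    code. *)
Lemma size_encode_nat_rec k fuel n :
  n < 2 ^ k -> size (encode_nat_rec fuel n) <= k.*2.+1.
Proof.
elim: k fuel n => [|k IH] [|fuel] n //=; first by case: n.
rewrite expnS => lt_n; case: eqP => //= _.
rewrite doubleS !ltnS; apply: IH; lia.
Qed.

(** Slot, degree and child count cost [2k+1] bits each, the two colors [4k+1] each, the level
    residue 5. *)
Lemma size_encode_label k L :
  slot L < 2 ^ k -> color L < 2 ^ k.*2 -> parent_color L < 2 ^ k.*2 ->
  max_deg L < 2 ^ k -> nchildren L < 2 ^ k -> level_mod3 L < 2 ^ 2 ->
  size (encode_label L) <= 14 * k + 10.
Proof.
move=> h1 h2 h3 h4 h5 h6; rewrite /encode_label !size_cat /encode_nat.
have := size_encode_nat_rec (slot L) h1; have := size_encode_nat_rec (color L) h2.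
have := size_encode_nat_rec (parent_color L) h3.
have := size_encode_nat_rec (max_deg L) h4.
have := size_encode_nat_rec (nchildren L) h5.
have := size_encode_nat_rec (level_mod3 L) h6.
lia.
Qed.

(** * Distances and the distance-two coloring *)

Section Distance.

Variables (V : finType) (E : rel V).

Lemma dist_le u v (q : seq V) :
  path E u q -> last u q = v -> dist E u v <= size q.
Proof.
move=> Eq uqv; rewrite /dist; set a := (X in find X _).
(* [find] never exceeds the length [#|V|] of the searched list, so only shorter walks matter. *)
have [lt_q|] := ltnP (size q) #|V|; last first.
  by apply: leq_trans; rewrite -[X in _ <= X](size_iota 0) find_size.
rewrite leqNgt; apply/negP => /(before_find 0); rewrite nth_iota // add0n.
by case/existsP; exists (in_tuple q); rewrite Eq uqv /=.
Qed.

Lemma dist_walk u v : connect E u v ->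
  exists q : seq V, [/\ path E u q, last u q = v & size q = dist E u v].
Proof.
case/connectP => q0 /shortenP[q Eq Uq _] ->{q0}.
have lt_q : size q < #|V|.
  by rewrite -[(size q).+1]/(size (u :: q)) -(card_uniqP Uq) max_card.
rewrite /dist; set a := (X in find X _).
have ha : has a (iota 0 #|V|).
  apply/hasP; exists (size q); first by rewrite mem_iota.
  by apply/existsP; exists (in_tuple q); rewrite Eq /=.
have := nth_find 0 ha; rewrite nth_iota ?add0n; last first.
  by rewrite -[X in _ < X](size_iota 0) -has_find.
case/existsP => t /andP[Et /eqP ut].
by exists t; split; rewrite ?size_tuple.
Qed.

Lemma dist_edge r u v : connect E r u -> E u v -> dist E r v <= (dist E r u).+1.
Proof.
move=> /dist_walk[q [Eq rq <-]] Euv.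
rewrite -(size_rcons q v); apply: dist_le; last exact: last_rcons.
by rewrite rcons_path Eq rq.
Qed.

Lemma dist_le_diameter u v : dist E u v <= diameter E.
Proof.
apply: leq_trans (leq_bigmax u).
exact: (leq_bigmax (F := dist E u)).
Qed.

Lemma distance2_inj (C : eqType) (c : V -> C) u v w :
  distance2_coloring E c -> E u v -> E v w -> c u = c w -> u = w.
Proof.
move=> col Euv Evw cuw; apply/eqP/idPn => /col/(_ _)/eqP[] //.
by apply: (@dist_le u w [:: v; w]); rewrite //= Euv Evw.
Qed.

Lemma distance1_inj (C : eqType) (c : V -> C) u v :
  distance2_coloring E c -> E u v -> c u = c v -> u = v.
Proof.
move=> col Euv cuv; apply/eqP/idPn => /col/(_ _)/eqP[] //.
by apply: ltnW; apply: (@dist_le u v [:: v]); rewrite //= Euv.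
Qed.

End Distance.

(** * The BFS tree and its smallest subtree containing root and sources *)

Section Tree.

Variables (V : finType) (E : rel V) (r : V) (p : V -> V).
Hypothesis conn : connected_graph E.
Hypothesis bfs : bfs_tree E r p.

Let root_parent : p r = r. Proof. by case: bfs => -[]. Qed.

Lemma level_parent v : v != r -> level r p v = (level r p (p v)).+1.
Proof.
case: bfs => -[_ _ tree] _ v_r.
by rewrite /level fconnect_findex // eq_sym.
Qed.

Lemma level_edge u v : E u v -> level r p v <= (level r p u).+1.
Proof.
case: bfs conn => _ lvl [_ _ cE]; rewrite !lvl; exact: dist_edge.
Qed.

Lemma level_le_diameter v : level r p v <= diameter E.
Proof. by case: bfs => _ ->; exact: dist_le_diameter. Qed.

Lemma num_children_le (W : {set V}) v : num_children r p W v <= max_degree E.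
Proof.
apply: leq_trans (leq_bigmax v); apply/subset_leq_card/subsetP => u.
case: bfs conn => -[_ tE _] _ [symE _ _].
by rewrite !inE => /andP[_ /andP[/tE + /eqP<-]]; rewrite symE.
Qed.

Section SmallestSubtree.

Variables src T' : {set V}.
Hypothesis minT : smallest_subtree r p src T'.

(** A walk in [T'] from [v] to [r] must leave the descendants of [v], and the only tree edge out of
    them joins [v] to [p v]. *)
Lemma subtree_parent v : v \in T' -> p v \in T'.
Proof.
case: minT => -[_ cT] rT _ _ vT.
have [->|v_r] := eqVneq v r; first by rewrite root_parent.
case/connectP: (cT _ _ vT rT) => q.
have: fconnect p v v by exact: connect0.
elim: q {1 3 4}v => [|y q IH] x xv /= => [_ rx|].
  move: xv; rewrite -rx => /iter_findex; elim: findex => [/= rv|n IH].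
    by rewrite rv eqxx in v_r.
  by rewrite iterSr root_parent.
case/andP=> /and3P[xT yT /orP[] /andP[_ /eqP xy]] qP qr; last first.
  by apply: IH qP qr; rewrite (connect_trans (fconnect1 _ _)) // xy.
move: xv; rewrite fconnect_eqVf xy => /orP[/eqP<-|yv]; first by rewrite xy.
exact: IH qP qr.
Qed.

(* By minimality it suffices that the ancestors of the sources, together with
   r, form a subtree. *)
Lemma subtree_below_source v :
  v \in T' -> v != r -> exists2 u, u \in src & fconnect p u v.
Proof.
case: minT => _ _ _ min; case: bfs => -[_ _ tree] _.
pose W := [set v | (v == r) || [exists u in src, fconnect p u v]].
have parW x : x \in W -> p x \in W.
  rewrite !inE => /orP[/eqP->|/exists_inP[u us ux]]; first by rewrite root_parent eqxx.
  apply/orP; right; apply/exists_inP; exists u => //.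
  exact: connect_trans ux (fconnect1 _ _).
set e := [rel x y | [&& x \in W, y \in W & tree_edge r p x y]].
have symE : symmetric e.
  by move=> x y; rewrite /= /tree_edge /= orbC andbCA.
have toR x : x \in W -> connect e x r.
  have := iter_findex (tree x); move: (findex _ _ _) => n.
  elim: n x => [x <- _|n IH x]; first exact: connect0.
  rewrite iterSr => xr xW; have [->|x_r] := eqVneq x r; first exact: connect0.
  apply: (@connect_trans _ _ (p x)); last exact: IH (parW _ xW).
  by apply: connect1; rewrite /e /= xW parW //= /tree_edge /= /child_of x_r eqxx.
have sT : subtree r p W.
  split; first by apply/set0Pn; exists r; rewrite inE eqxx.
  move=> u w uW wW; apply: connect_trans (toR u uW) _.
  by rewrite (sym_connect_sym symE) toR.
have /subsetP sub : T' \subset W.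
  apply: min sT _ _; first by rewrite inE eqxx.
  apply/subsetP => u us; rewrite inE; apply/orP; right.
  by apply/exists_inP; exists u => //; exact: connect0.
move=> /sub; rewrite inE => /orP[->//|/exists_inP[u us uv] _]; by exists u.
Qed.

(** The witness is the last node before [v] on the parent chain from [u], which stays in [T'] by
    [subtree_parent]. *)
Lemma child_towards u v :
  u \in T' -> fconnect p u v -> u != v ->
  exists w, [/\ w \in T', child_of r p w v & fconnect p u w].
Proof.
move=> uT /iter_findex; move: (findex _ _ _) => n.
elim: n u uT => [|n IH] u uT; first by move=> <-; rewrite eqxx.
rewrite iterSr => uv u_v; have [pu|pu] := eqVneq (p u) v; last first.
  have [w [wT wv uw]] := IH _ (subtree_parent uT) uv pu.
  by exists w; split=> //; rewrite (connect_trans (fconnect1 _ _)).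
exists u; split=> //.
rewrite /child_of pu eqxx andbT; apply: contra_neq u_v => u_r.
by rewrite -pu u_r root_parent.
Qed.

Lemma nchildren_gt0_mem v : 0 < num_children r p T' v -> v \in T'.
Proof.
case/card_gt0P => u; rewrite inE => /and3P[uT _ /eqP<-]; exact: subtree_parent.
Qed.

(** A source strictly below [v] would put a child of [v] into [T']. *)
Lemma nchildren0_source u v :
  num_children r p T' v = 0 -> u \in src -> fconnect p u v -> u = v.
Proof.
case: minT => _ _ /subsetP sT _ v0 /sT uT uv; apply/eqP/idPn => u_v.
have [w [wT wv _]] := child_towards uT uv u_v.
suff: 0 < num_children r p T' v by rewrite v0.
by apply/card_gt0P; exists w; rewrite inE wT.
Qed.

End SmallestSubtree.

End Tree.

(** * Reception in a single round, and histories *)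

Section Heard.

Variables (M : eqType) (P : protocol M) (V : finType) (E : rel V).
Implicit Types (a : V -> option (packet P)) (v w : V).

Lemma heard_neighbor a v m :
  heard E a v = Some m -> exists2 w, E v w & a w = Some m.
Proof.
rewrite /heard; case: (isSome (a v)) => //.
case hs: [seq _ <- _ | _] => [|w [|//]] // aw; exists w => //.
have : w \in [:: w] by rewrite inE.
by rewrite -hs mem_filter => /andP[/andP[]].
Qed.

Lemma heard_unique a v w m :
  a v = None -> E v w -> a w = Some m ->
  (forall w', E v w' -> isSome (a w') -> w' = w) -> heard E a v = Some m.
Proof.
move=> av Evw aw uw; rewrite /heard av /=.
rewrite (@eq_filter _ _ (pred1 w)).
  by rewrite filter_pred1_uniq ?enum_uniq ?mem_enum.
move=> w' /=; apply/andP/eqP => [[]|->]; first exact: uw.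
by rewrite aw.
Qed.

Variables (lab : V -> bitseq) (inp : V -> option M).

(** As a list over rounds, histories at two times compare by splitting [iota]. *)
Lemma history_pmap t v :
  history P E lab inp t v =
  pmap (fun i => omap (pair i) (heard E (action P E lab inp i) v)) (iota 0 t).
Proof.
elim: t => // t IH; rewrite -[in RHS]addn1 iotaD pmap_cat /= add0n -IH.
rewrite -/(action P E lab inp t); case: heard => [m|] /=; last by rewrite cats0.
by rewrite cats1.
Qed.

End Heard.

(** * Equality of packets, which gives membership in a history a meaning *)

Section GpacketEqType.

Variable M : eqType.

Definition gpacket_code (x : gpacket M) :=
  (pk_msgs x, pk_color x, pk_parent_color x).

Definition gpacket_decode (y : seq M * nat * nat) := GPacket y.1.1 y.1.2 y.2.

Lemma gpacket_codeK : cancel gpacket_code gpacket_decode.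
Proof. by case. Qed.

HB.instance Definition _ := Equality.copy (gpacket M) (can_type gpacket_codeK).

End GpacketEqType.

(** * The closest admissible phase *)

Lemma closest_phase_exists d s q :
  s < d -> exists q', [/\ closest_phase d s q q', q < q' & q' <= q + d].
Proof.
move=> lt_s; have d_gt0 : 0 < d by apply: leq_ltn_trans lt_s.
have ex : exists n, (q < n) && (n %% d == s).
  exists (q.+1 * d + s); rewrite modnMDl modn_small // eqxx andbT.
  nia.
case: (ex_minnP ex) => n /andP[lt_qn ns] min; exists n.
have le_n : n <= q + d.
  have := divn_eq q d; have := ltn_pmod q d_gt0.
  (* The block of [d] phases containing [q] still offers residue [s] after [q] iff [q %% d < s];
     otherwise the next block does. *)
  have [le_sq|lt_sq] := leqP s (q %% d) => lt_q eq_q.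
    by apply: leq_trans (min ((q %/ d).+1 * d + s) _) _; 
       rewrite ?modnMDl ?(modn_small lt_s) ?eqxx ?andbT; nia.
  by apply: leq_trans (min (q %/ d * d + s) _) _;
     rewrite ?modnMDl ?(modn_small lt_s) ?eqxx ?andbT; nia.
split=> //; rewrite /closest_phase lt_qn ns /=.
apply/allP => i; rewrite mem_index_iota => /andP[lt_qi lt_in].
apply/negP => is_; have := min i; rewrite lt_qi is_ => /(_ isT).
by rewrite leqNgt lt_in.
Qed.

Lemma closest_phase_le d s q q' :
  s < d -> closest_phase d s q q' -> q' <= q + d.
Proof.
move=> /(closest_phase_exists q)[n [/and3P[_ ns _] lt_qn le_n]] /and3P[lt_q _ /allP h].
rewrite leqNgt; apply/negP => lt_nq; have /h : n \in index_iota q.+1 q'.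
  by rewrite mem_index_iota lt_qn (leq_ltn_trans le_n).
by rewrite ns.
Qed.

(** * Transmissions of the algorithm and their reception *)

Section Gathering.

Variables (V : finType) (E : rel V) (r : V) (p : V -> V).
Variables (s : V -> 'I_(max_degree E)) (c : V -> 'I_(max_degree E ^ 2).+1).
Variables (src T' : {set V}) (M : eqType) (msg : V -> M).
Hypotheses (conn : connected_graph E) (bfs : bfs_tree E r p).
Hypotheses (slots : slot_function E r p s) (col : distance2_coloring E c).
Hypothesis minT : smallest_subtree r p src T'.

Local Notation lvl := (level r p).
Local Notation inp := (source_input src msg).
Local Notation sent := (action (gathering_algorithm M) E (labeling r p s c T') inp).

Let label_of v := Label (s v) (c v) (c (p v)) (max_degree E)
                        (num_children r p T' v) (lvl v %% 3).

Let hist t v : seq (nat * gpacket M) :=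
  history (gathering_algorithm M) E (labeling r p s c T') inp t v.

Let child_edge u v : child_of r p u v -> E u v.
Proof. by case: bfs => -[_ tE _] _ /andP[/tE + /eqP<-]. Qed.

Let symE u v : E u v = E v u. Proof. by case: conn. Qed.

(** The slot of [r] inhabits ['I_(max_degree E)], which excludes the one-vertex graph. *)
Let max_degree_gt0 : 0 < max_degree E.
Proof. exact: leq_ltn_trans (ltn_ord (s r)). Qed.

Let level_child u v : child_of r p u v -> lvl u = (lvl v).+1.
Proof. by case/andP=> u_r /eqP<-; rewrite (level_parent bfs u_r). Qed.

Lemma sent_inv t v m : sent t v = Some m ->
  [/\ t %% 3 = lvl v %% 3,
      sends_in_phase (label_of v) (inp v) (hist t v) (t %/ 3)
    & m = GPacket (messages_to_send (label_of v) (inp v) (hist t v))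
                  (c v) (c (p v))].
Proof.
rewrite /action /act /= /gather_decide /labeling encode_labelK -/(label_of v).
case: ifP => // _; case: ifP => // /andP[/eqP tl sp] [<-]; by split.
Qed.

Lemma sends_sent t v :
  isSome (inp v) || ~~ nilp (hist t v) -> t %% 3 = lvl v %% 3 ->
  sends_in_phase (label_of v) (inp v) (hist t v) (t %/ 3) ->
  exists m, sent t v = Some m.
Proof.
move=> awake tl sp; rewrite /action /act -/(hist t v) awake /= /gather_decide.
by rewrite /labeling encode_labelK -/(label_of v) tl eqxx sp; eexists.
Qed.

Lemma mem_hist t v x :
  x \in hist t v <-> x.1 < t /\ heard E (sent x.1) v = Some x.2.
Proof.
rewrite /hist history_pmap mem_pmap; split.
  case/mapP => i; rewrite mem_iota /= add0n => lt_it.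
  by case hm: (heard _ _) => [m|] //= [->].
case: x => i m /= [lt_it hm]; apply/mapP; exists i; first by rewrite mem_iota.
by rewrite hm.
Qed.

Lemma hist_cat t t' v : t <= t' ->
  exists h, hist t' v = hist t v ++ h /\ {in h, forall x, t <= x.1}.
Proof.
move=> le_t; rewrite /hist !history_pmap -{1}(subnKC le_t) iotaD pmap_cat add0n.
eexists; split; first reflexivity.
move=> x; rewrite mem_pmap => /mapP[i]; rewrite mem_iota => /andP[le_ti _].
by case: (heard _ _) => //= m [->].
Qed.

Lemma sent_subtree t v m : sent t v = Some m -> v \in T'.
Proof.
case/sent_inv => _ + _; rewrite /sends_in_phase /= /source_input.
case: eqP => [_|/eqP]; last first.
  by rewrite -lt0n => /(nchildren_gt0_mem bfs minT).
by case: ifP => //; case: minT => _ _ /subsetP sT _ /sT.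
Qed.

Lemma sent_slot t v m : sent t v = Some m -> (t %/ 3) %% max_degree E = s v.
Proof.
case/sent_inv => _ + _; rewrite /sends_in_phase /=.
case: ifP => [_ /andP[_ /eqP->]|_ /andP[_ /and3P[_ /eqP//]]].
by rewrite modn_small.
Qed.

(* Neighbours of [p v] that transmit in the same round as [v] have a level
   congruent to that of [v] modulo 3, hence the same level, and the same slot. *)
Lemma parent_hears t v m :
  v != r -> sent t v = Some m -> heard E (sent t) (p v) = Some m.
Proof.
move=> v_r sv; have lv := level_parent bfs v_r.
have [tv _ _] := sent_inv sv.
apply: (heard_unique (w := v)) => //.
(* Consecutive levels differ modulo 3, so [p v] listens in this round. *)
- case sp: (sent t (p v)) => [m'|] //.
  by have [tp _ _] := sent_inv sp; lia.
- by rewrite symE; case: bfs => -[_ /(_ _ v_r)].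
move=> w Epw; case sw: (sent t w) => [m'|] // _.
have [tw _ _] := sent_inv sw.
have := level_edge conn bfs Epw; rewrite symE in Epw.
have := level_edge conn bfs Epw => le1 le2.
apply/eqP/idPn => w_v; case: slots => _ /(_ _ _ w_v).
rewrite Epw => slot2; suff: ~~ true by [].
apply: slot2; first lia.
by apply: val_inj; rewrite /= -(sent_slot sv) -(sent_slot sw).
Qed.

(** The sender [w] is adjacent to both [v] and [p w], which carry the same color and so coincide by
    the distance-two coloring. *)
Lemma from_child_sender t v x :
  x \in hist t v -> from_child (label_of v) x ->
  exists w, [/\ w \in T', child_of r p w v & sent x.1 w = Some x.2].
Proof.
case/mem_hist => _ /heard_neighbor[w Evw sw].
have [_ _ ex] := sent_inv sw; rewrite /from_child ex /= -ex => /eqP cw.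
exists w; split=> //; first exact: sent_subtree sw.
(* The root stores its own color as parent color, which no neighbour [v] can share. *)
have [w_r|w_r] := eqVneq w r.
  have root_parent : p r = r by case: bfs => -[].
  have v_r : v = r.
    apply: (distance1_inj col); first by rewrite -[r]w_r.
    by apply: val_inj; rewrite /= -cw w_r root_parent.
  by case: conn => _ irrE _; rewrite w_r v_r irrE in Evw.
rewrite /child_of w_r /=; apply/eqP; move/val_inj in cw.
apply: (distance2_inj col _ _ cw); last by rewrite symE; exact: Evw.
by rewrite symE; case: bfs => -[_ /(_ _ w_r)].
Qed.

Let kids v := [set u in T' | child_of r p u v].

Let child_colors t v :=
  [seq pk_color x.2 | x <- hist t v & from_child (label_of v) x].

Lemma color_inj_children v : {in kids v &, injective c}.
Proof.
move=> u w; rewrite !inE => /andP[_ /child_edge Euv] /andP[_ /child_edge Ewv].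
by apply: (distance2_inj col Euv); rewrite symE.
Qed.

Lemma child_colors_sub t v :
  {subset child_colors t v <= [seq val (c u) | u in kids v]}.
Proof.
move=> _ /mapP[x + ->]; rewrite mem_filter => /andP[fx xh].
have [w [wT wv sw]] := from_child_sender xh fx; have [_ _ ->] := sent_inv sw.
by apply/imageP; exists w; rewrite ?inE ?wT.
Qed.

Lemma child_hist t v w m : child_of r p w v -> sent t w = Some m ->
  forall t', t < t' -> (t, m) \in hist t' v.
Proof.
case/andP=> w_r /eqP<- sw t' lt_t; apply/mem_hist; split=> //.
exact: parent_hears.
Qed.

(** The distinct colors heard lie among those of the children and are equally many, so the color of
    [w] was heard; no other child has it. *)
Lemma heard_all_children t v w :
  heard_children (label_of v) (hist t v) = num_children r p T' v ->
  w \in T' -> child_of r p w v ->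
  exists2 x, x \in hist t v & sent x.1 w = Some x.2.
Proof.
move=> eq_n wT wv.
have sub : {subset undup (child_colors t v) <= [seq val (c u) | u in kids v]}.
  by move=> i; rewrite mem_undup => /child_colors_sub.
have le_size : size [seq val (c u) | u in kids v] <= size (undup (child_colors t v)).
  by rewrite size_image -[X in _ <= X]/(heard_children _ _) eq_n.
have [_ eq_colors] := uniq_min_size (undup_uniq _) sub le_size.
have : val (c w) \in undup (child_colors t v).
  by rewrite eq_colors; apply/imageP; exists w; rewrite ?inE ?wT.
rewrite mem_undup => /mapP[x]; rewrite mem_filter => /andP[fx xh] cw.
exists x => //; have [w' [w'T w'v sw']] := from_child_sender xh fx.
have [_ _ ex] := sent_inv sw'; rewrite ex /= in cw.
suff -> : w = w' by [].
by apply: (@color_inj_children v); rewrite ?inE ?wT ?w'T //; apply: val_inj.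
Qed.

(** Ties [last_child_phase] to an actual transmission: the list of child packets is nonempty, so the
    default 0 of [last] does not occur. *)
Lemma last_child t v :
  0 < heard_children (label_of v) (hist t v) ->
  exists t' w m, [/\ w \in T', child_of r p w v, sent t' w = Some m, t' < t
                   & last_child_phase (label_of v) (hist t v) = t' %/ 3].
Proof.
rewrite /heard_children /last_child_phase => gt0.
have: all (fun x => x \in hist t v) [seq x <- hist t v | from_child (label_of v) x].
  by apply/allP => x; rewrite mem_filter => /andP[].
have: all (from_child (label_of v)) [seq x <- hist t v | from_child (label_of v) x].
  exact: filter_all.
move: gt0; case/lastP: [seq _ <- _ | _] => [//|h x] _.
rewrite !all_rcons => /andP[fx _] /andP[xh _]; rewrite map_rcons last_rcons.
have [w [wT wv sw]] := from_child_sender xh fx.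
by exists x.1, w, x.2; split=> //; case/mem_hist: xh.
Qed.

(** * Time and content of transmissions *)

Lemma sent_phase_bound t v m : sent t v = Some m ->
  t %/ 3 < (diameter E - lvl v).+1 * max_degree E.
Proof.
elim/ltn_ind: t v m => t IH v m /sent_inv[_ + _]; rewrite /sends_in_phase /=.
case: eqP => [_ /andP[_ /eqP->]|/eqP n0 /andP[/eqP hc cl]].
  by apply: leq_trans (ltn_ord (s v)) _; rewrite leq_pmull.
have := @last_child t v; rewrite hc lt0n => /(_ n0)[t' [w [m' [_ wv sw lt_t lp]]]].
have := IH _ lt_t _ _ sw; have := closest_phase_le (ltn_ord _) cl; rewrite lp.
(* As [lvl w = (lvl v).+1] is at most the diameter, the subtraction is not truncated, and [v] gets
   [max_degree E] more phases than [w]. *)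
have := level_le_diameter bfs w; rewrite (level_child wv) => le_D.
by rewrite -[in X in _ < X -> _]subSn // subSS [in X in _ -> _ < X]mulSn; lia.
Qed.

Lemma sent_messages t v m u : sent t v = Some m ->
  u \in src -> fconnect p u v -> msg u \in pk_msgs m.
Proof.
elim/ltn_ind: t v m => t IH v m sv us uv.
have uT : u \in T' by case: minT => _ _ /subsetP/(_ _ us).
have [_ + ->] := sent_inv sv; rewrite /= /messages_to_send /sends_in_phase /=.
case: eqP => [n0 _|_ /andP[/eqP hc _]].
  by rewrite -(nchildren0_source bfs minT n0 us uv) /source_input us inE.
rewrite /known_messages mem_cat.
have [u_v|u_v] := eqVneq u v; first by rewrite -u_v /source_input us inE eqxx.
have [w [wT wv uw]] := child_towards bfs minT uT uv u_v.
have [x xh sw] := heard_all_children hc wT wv.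
apply/orP; right; apply/flatten_mapP; exists x => //.
by apply: IH sw us uw; case/mem_hist: xh.
Qed.

(** Three rounds for each phase that [sent_phase_bound] allows on level 0. *)
Let horizon := 3 * ((diameter E).+1 * max_degree E).

Lemma sent_before_horizon t v m : sent t v = Some m -> t < horizon.
Proof.
move=> /sent_phase_bound lt_t; rewrite /horizon mulnC -ltn_divLR //.
by apply: leq_trans lt_t _; rewrite leq_mul2r ltnS leq_subr orbT.
Qed.

(* After the last child has been heard, the packets from children no longer
   change, so at the scheduled phase v sees the same data as at the horizon. *)
Lemma inner_node_sends v :
  (forall w, w \in T' -> child_of r p w v -> exists t m, sent t w = Some m) ->
  0 < num_children r p T' v -> exists t m, sent t v = Some m.
Proof.
move=> kids_send n_gt0.
(* By the horizon every child has been heard, and distinct children have distinct colors. *)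
have hc : heard_children (label_of v) (hist horizon v) = num_children r p T' v.
  apply/eqP; rewrite eqn_leq; apply/andP; split.
    rewrite /num_children -(size_image (fun u => val (c u))).
    apply: uniq_leq_size; first exact: undup_uniq.
    by move=> i; rewrite mem_undup => /child_colors_sub.
  rewrite /num_children -(size_image (fun u => val (c u))).
  apply: uniq_leq_size.
    apply/dinjectiveP => u w uk wk /val_inj; exact: (color_inj_children (v := v)).
  move=> _ /imageP[w wk ->]; rewrite mem_undup.
  move: wk; rewrite inE => /andP[wT wv]; have [t [m sw]] := kids_send _ wT wv.
  have := child_hist wv sw (sent_before_horizon sw) => xh.
  have [_ _ em] := sent_inv sw.
  apply/mapP; exists (t, m); last by rewrite em.
  by rewrite mem_filter xh andbT /from_child /= em /=; case/andP: wv => _ /eqP->.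
have := @last_child horizon v; rewrite hc => /(_ n_gt0)[t' [w [m' [wT wv sw lt_t' lp]]]].
have [q [cl lt_q le_q]] := closest_phase_exists (t' %/ 3) (ltn_ord (s v)).
pose t := 3 * q + lvl v %% 3.
have tq : t %/ 3 = q.
  by rewrite /t mulnC divnMDl // [_ %% 3 %/ 3]divn_small ?addn0 ?ltn_pmod.
have tl : t %% 3 = lvl v %% 3 by rewrite /t mulnC modnMDl modn_mod.
(* The child [w] is one level deeper than [v], which leaves room for [max_degree E] further
   phases. *)
have le_tT : t <= horizon.
  have := sent_phase_bound sw; have := level_le_diameter bfs w.
  rewrite (level_child wv) => le_D; rewrite -subSn // subSS => lt1.
  have lt2 : q < (diameter E).+1 * max_degree E.
    apply: leq_ltn_trans le_q _; rewrite mulSn addnC ltn_add2l.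
    by apply: leq_trans lt1 _; rewrite leq_mul2r leq_subr orbT.
  by have := ltn_pmod (lvl v) (isT : 0 < 3); rewrite /t /horizon; lia.
(* If child packets were heard from round [t] on, the last one would fall in phase [q] or later, yet
   its phase is [t' %/ 3 < q]. *)
have eq_kids : [seq x <- hist t v | from_child (label_of v) x] =
               [seq x <- hist horizon v | from_child (label_of v) x].
  have [h [eqh ge_h]] := hist_cat v le_tT.
  have : {in [seq x <- h | from_child (label_of v) x], forall x, t <= x.1}.
    by move=> x; rewrite mem_filter => /andP[_ /ge_h].
  move: lp; rewrite /last_child_phase eqh filter_cat.
  case/lastP: [seq x <- h | _] => [|h' x]; first by rewrite cats0.
  rewrite -rcons_cat map_rcons last_rcons => lp /(_ x).
  by rewrite mem_rcons inE eqxx => /(_ isT)/(leq_div2r 3); rewrite tq lp leqNgt lt_q.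
have hct : heard_children (label_of v) (hist t v) = num_children r p T' v.
  by rewrite -hc /heard_children eq_kids.
exists t; apply: sends_sent => //.
  apply/orP; right; move: n_gt0; rewrite -hct; apply: contraTN => /nilP.
  by rewrite /heard_children => ->.
rewrite /sends_in_phase /= eqn0Ngt n_gt0 /= hct eqxx tq /=.
by rewrite /last_child_phase eq_kids -/(last_child_phase _ _) lp.
Qed.

Lemma subtree_sends v : v \in T' -> v != r -> exists t m, sent t v = Some m.
Proof.
have [n] := ubnP (diameter E - lvl v); elim: n v => // n IH v le_n vT v_r.
have [n0|] := posnP (num_children r p T' v).
  (* A node without children in [T'] is itself the source found below it. *)
  have [u us uv] := subtree_below_source bfs minT vT v_r.
  have vs : v \in src by rewrite -(nchildren0_source bfs minT n0 us uv).
  exists (3 * s v + lvl v %% 3); apply: sends_sent.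
  - by rewrite /source_input vs.
  - by rewrite mulnC modnMDl modn_mod.
  rewrite /sends_in_phase /= n0 /source_input vs /=.
  by rewrite mulnC divnMDl // [_ %% 3 %/ 3]divn_small ?addn0 ?ltn_pmod.
apply: inner_node_sends => w wT wv; apply: IH wT _; last by case/andP: wv.
by have := level_le_diameter bfs w; rewrite (level_child wv) in le_n *; lia.
Qed.

(** A source other than [r] lies below a child of [r] in [T'], whose packet carries its message and
    arrives before the horizon. *)
Lemma gathering_correct T : horizon <= T ->
  gathers_in_time (gathering_algorithm M) E (labeling r p s c T') r src msg T.
Proof.
move=> le_T; split=> [u us|t v le_t]; last first.
  case sv: (action _ _ _ _ t v) => [m|] //.
  by have := sent_before_horizon sv; rewrite ltnNge (leq_trans le_T le_t).
have uT : u \in T' by case: minT => _ _ /subsetP/(_ _ us).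
rewrite /= /known_messages mem_cat -/(hist T r).
have [u_r|u_r] := eqVneq u r; first by rewrite -u_r /source_input us inE eqxx.
have ur : fconnect p u r by case: bfs => -[].
have [w [wT wr uw]] := child_towards bfs minT uT ur u_r.
have [t [m sw]] := subtree_sends wT (proj1 (andP wr)).
apply/orP; right; apply/flatten_mapP; exists (t, m).
  by apply: (child_hist wr sw); apply: leq_trans le_T; apply: sent_before_horizon sw.
exact: sent_messages sw us uw.
Qed.

(** * The bounds on time and label size *)

Lemma diameter_gt0 : 0 < diameter E.
Proof.
case: conn => _ irrE cE; rewrite lt0n; apply/eqP => D0.
(* With diameter 0 no node would have a neighbour. *)
move: max_degree_gt0; rewrite ltnNge => /negP[]; apply/bigmax_leqP => v _.
rewrite leqn0 cards_eq0; apply/eqP/setP => w; rewrite !inE; apply/negP => Evw.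
have := dist_le_diameter E v w; rewrite D0 leqn0 => /eqP d0.
have [q [_ vq]] := dist_walk (cE v w); rewrite d0 => /size0nil q0.
by move: Evw; rewrite -vq q0 /= irrE.
Qed.

(** A positive diameter [D] gives [D + 1 <= 2D], whence the constant [6 = 3 * 2]. *)
Lemma horizon_le : horizon <= 6 * (diameter E * max_degree E).
Proof. have := diameter_gt0; rewrite /horizon mulSn; nia. Qed.

Lemma size_labeling v :
  size (labeling r p s c T' v) <= 24 * (trunc_log 2 (max_degree E)).+1.
Proof.
(* The number of binary digits of the degree; colors, at most its square, fit into [2k] digits. *)
pose k := (trunc_log 2 (max_degree E)).+1.
have lt_deg : max_degree E < 2 ^ k by exact: trunc_log_ltn.
have lt_deg2 : (max_degree E) ^ 2 < 2 ^ k.*2.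
  by rewrite -muln2 expnM ltn_exp2r.
apply: leq_trans (size_encode_label (k := k) _ _ _ _ _ _) _ => /=.
- exact: ltn_trans (ltn_ord _) lt_deg.
- by apply: leq_ltn_trans lt_deg2; rewrite -ltnS.
- by apply: leq_ltn_trans lt_deg2; rewrite -ltnS.
- by [].
- by apply: leq_ltn_trans lt_deg; apply: num_children_le.
- by apply: ltn_trans (ltn_pmod _ _) _.
(* Since [k >= 1], [14k + 10 <= 24k]. *)
by rewrite -/k; lia.
Qed.

End Gathering.

Theorem lemma4 :
  exists Ctime Csize : nat,
  forall (V : finType) (E : rel V) (r : V) (p : V -> V)
         (s : V -> 'I_(max_degree E)) (c : V -> 'I_(max_degree E ^ 2).+1)
         (k : nat) (src T' : {set V}),
    connected_graph E ->
    bfs_tree E r p ->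
    slot_function E r p s ->
    distance2_coloring E c ->
    #|src| = k ->
    smallest_subtree r p src T' ->
    (forall (M : eqType) (msg : V -> M),
       gathers_in_time (gathering_algorithm M) E (labeling r p s c T')
         r src msg (Ctime * (diameter E * max_degree E))) /\
    (* the summand 1 only matters for max_degree E = 1, where the logarithm is 0 *)
    \max_(v : V) size (labeling r p s c T' v)
      <= Csize * (trunc_log 2 (max_degree E)).+1.
Proof.
exists 6, 24 => V E r p s c k src T' conn bfs slots col _ minT; split.
  by move=> M msg; apply: gathering_correct => //; exact: (horizon_le r s conn).
by apply/bigmax_leqP => v _; apply: size_labeling.
Qed.
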